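(* Fix an integer $r\ge1$. For each $n$ let $X$ be a random subcomplex of the standard simplex $\Delta_n$ on the vertex set $\{1,\dots,n\}$ with distribution $\mathbb P(X)=2^{-H(X)}$, $H(X)=|F(X)|+|E(X)|$. Then the probability that $X$ is $r$-ample tends to $1$ as $n\to\infty$.
   Context: A subcomplex $X\subseteq\Delta_n$ is any simplicial complex whose simplexes are nonempty subsets of $\{1,\dots,n\}$. $F(X)$ is the set of simplexes of $X$; $E(X)$ is the set of simplexes $\sigma$ of $\Delta_n$ with $\sigma\notin X$ but all proper nonempty faces of $\sigma$ in $X$. $\mathbb P(X)=2^{-H(X)}$ is a probability measure on subcomplexes of $\Delta_n$. For $U\subseteq V(X)$, $X_U$ is the induced subcomplex on $U$; $\mathrm{Lk}_X(v)$ is the subcomplex of simplexes $\sigma$ with $v\notin\sigma$, $\sigma\cup\{v\}\in X$. A nonempty simplicial complex $X$ is $r$-ample if for every $U\subseteq V(X)$ with $|U|\le r$ and every subcomplex $A\subseteq X_U$ (possibly empty) there exists $v\in V(X)\setminus U$ with $\mathrm{Lk}_X(v)\cap X_U=A$. *)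

(* Defs.v *)
From HB Require Import structures.
From mathcomp Require Import all_boot all_order all_algebra.

Set Implicit Arguments.
Unset Strict Implicit.
Unset Printing Implicit Defensive.

Import Order.TTheory GRing.Theory Num.Theory.
Local Open Scope ring_scope.

Section Complexes.
Variable T : finType.
Implicit Types (X A : {set {set T}}) (U s t : {set T}) (v : T).

(* A simplicial complex with vertices among the points of [T] is represented by
   its set of simplexes; the empty complex is allowed, and a point of [T] need
   not be a vertex. *)
Definition is_complex X : bool :=
  (set0 \notin X) &&
  [forall s in X, forall t, (t != set0) && (t \subset s) ==> (t \in X)].

Record subcomplex := Subcomplex {
  simplexes :> {set {set T}};
  _ : is_complex simplexes }.

HB.instance Definition _ := [isSub for simplexes].
HB.instance Definition _ := [Finite of subcomplex by <:].

Definition vertices X : {set T} := [set v | [set v] \in X].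

(* In particular, a point of [T] that is not a vertex of [X] gives an
   element [set v] of [external X]. *)
Definition external X : {set {set T}} :=
  [set s | [&& s != set0, s \notin X &
     [forall t, (t != set0) && (t \proper s) ==> (t \in X)]]].

Definition induced X U : {set {set T}} := [set s in X | s \subset U].

Definition link X v : {set {set T}} :=
  [set s in X | (v \notin s) && (v |: s \in X)].

Definition ample (r : nat) X : bool :=
  (X != set0) &&
  [forall U : {set T}, (U \subset vertices X) && (#|U| <= r)%N ==>
    [forall A : {set {set T}}, is_complex A && (A \subset induced X U) ==>
      [exists v, (v \in vertices X :\: U) &&
                 (link X v :&: induced X U == A)]]].

Definition energy X : nat := (#|X| + #|external X|)%N.

End Complexes.

Definition complex_law (R : numFieldType) (T : finType) (X : subcomplex T) : R :=
  2 ^- energy X.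

Definition complex_prob (R : numFieldType) (T : finType)
    (P : pred (subcomplex T)) : R :=
  \sum_(X : subcomplex T | P X) complex_law R X.

Section Normalization.
Variable T : finType.
Implicit Types (X S : {set {set T}}) (s t : {set T}).

Let core S : {set {set T}} :=
  [set s | (s != set0) &&
     [forall t, (t != set0) && (t \subset s) ==> (t \in S)]].

Let core_complex S : is_complex (core S).
Proof.
apply/andP; split; first by rewrite inE eqxx.
apply/forall_inP => s; rewrite inE => /andP[_ /forallP sS].
apply/forallP => t; apply/implyP => /andP[t0 ts]; rewrite inE t0 /=.
apply/forallP => u; apply/implyP => /andP[u0 ut].
by apply: (implyP (sS u)); rewrite u0 (subset_trans ut ts).
Qed.

Let core_eq S X : is_complex X ->
  (core S == X) = (X \subset S) && [disjoint external X & S].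
Proof.
move=> /andP[X0 /forall_inP Xd].
have Xn s : s \in X -> s != set0 by apply: contraTneq => ->.
apply/eqP/andP => [SX|[XS XE]].
  split.
    apply/subsetP => s; rewrite -SX inE => /andP[s0 /forallP/(_ s)].
    by rewrite s0 subxx.
  apply/pred0P => s /=; apply/negbTE/negP => /andP[].
  rewrite inE => /and3P[s0 /negP sX /forallP sE] sS; apply: sX.
  rewrite -SX inE s0; apply/forallP => t; apply/implyP => /andP[t0 ts].
  have [->//|ts'] := eqVneq t s.
  have : t \in X.
    by apply: (implyP (sE t)); rewrite t0 properEneq ts' ts.
  by rewrite -SX inE => /andP[_ /forallP/(_ t)]; rewrite t0 subxx.
apply/setP => s; apply/idP/idP.
  elim: {s}#|s| {-2}s (leqnn #|s|) => [|n IH] s.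
    by rewrite leqn0 cards_eq0 => /eqP ->; rewrite inE eqxx.
  move=> sn sS; move: (sS); rewrite inE => /andP[s0 /forallP sc].
  apply: contraT => sX; move/pred0P: XE => /(_ s) /=.
  rewrite (_ : s \in S); last by move: (sc s); rewrite s0 subxx.
  rewrite andbT inE s0 sX /= => /forallP[] t.
  apply/implyP => /andP[t0 ts]; apply: IH.
    by rewrite -ltnS; apply: leq_trans (proper_card ts) sn.
  case/andP: (core_complex S) => _ /forall_inP/(_ _ sS)/forallP/(_ t).
  by rewrite t0 (proper_sub ts).
move=> sX; rewrite inE Xn //=; apply/forallP => t; apply/implyP => tP.
by apply: (subsetP XS); apply: (implyP (forallP (Xd s sX) t)).
Qed.

Let card_interval (A B : {set {set T}}) : [disjoint A & B] ->
  (#|[set S : {set {set T}} | (A \subset S) && [disjoint B & S]]|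
     * 2 ^ (#|A| + #|B|) = 2 ^ #|{set T}|)%N.
Proof.
move=> AB.
have -> : [set S : {set {set T}} | (A \subset S) && [disjoint B & S]]
        = [set (A :|: S) | S in powerset (~: (A :|: B))].
  apply/setP => S; rewrite inE; apply/andP/imsetP => [[AS BS]|[S' S'P ->]].
    exists (S :\: A); last first.
      by rewrite setDE setUIr setUCr setIT; apply/esym/setUidPr.
    rewrite inE; apply/subsetP => s; rewrite !inE => /andP[/negbTE -> sS] /=.
    by rewrite (disjointFl BS sS).
  split; first exact: subsetUl.
  apply/pred0P => s /=; apply/negbTE/negP => /andP[sB]; rewrite inE.
  rewrite (disjointFl AB sB) /= => sS'.
  by move: S'P; rewrite inE => /subsetP/(_ s sS'); rewrite !inE sB orbT.
rewrite card_in_imset; last first.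
  move=> S1 S2; rewrite !inE => /subsetP h1 /subsetP h2 /setP h.
  apply/setP => s; move: (h s) (h1 s) (h2 s); rewrite !inE.
  case: (s \in A) => //= _.
  by do 2 case: (s \in _) => //; move=> a b; [have := a isT | have := b isT].
rewrite card_powerset -expnD; congr (2 ^ _)%N.
by rewrite -(cardsC (A :|: B)) addnC cardsU (disjoint_setI0 AB) cards0 subn0.
Qed.

(* [core S] is the largest complex contained in the family [S], and [core S = X]
   for exactly [2 ^ (#|{set T}| - energy X)] families [S]. *)
Lemma complex_prob_total (R : numFieldType) :
  complex_prob R (@predT (subcomplex T)) = 1.
Proof.
have n0 k : (2 ^+ k : R) != 0 by rewrite expf_neq0 // pnatr_eq0.
apply: (mulIf (n0 #|{set T}|)); rewrite mul1r /complex_prob mulr_suml.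
pose f S := Subcomplex (core_complex S).
have cF : (2 ^ #|{set T}| = \sum_(S : {set {set T}}) 1)%N.
  by rewrite sum1_card -[in RHS]cardsT -powersetT card_powerset cardsT.
rewrite -[in RHS]natrX cF natr_sum.
rewrite (partition_big f predT) //=; apply: eq_bigr => X _.
rewrite -natr_sum -natrX.
have XE : [disjoint X : {set {set T}} & external X].
  by apply/pred0P => s /=; rewrite !inE; case: (s \in _); rewrite ?andbF.
rewrite -(card_interval XE) natrM mulrC natrX mulfK; last exact: n0.
congr _%:R; rewrite -sum1dep_card; apply: eq_bigl => S.
by rewrite -core_eq ?(valP X).
Qed.

End Normalization.

(* Main.v *)
(* Choose a family [S] of subsets uniformly at random; the largest complex
   contained in [S] equals [X] exactly when [S] contains [X] and misses
   [external X], so it has the law [2 ^- energy X]. For a set [U] of at most [r]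
   points and a complex [A] on [U], a point [v] outside [U] extends [A] as soon
   as, among the sets [v |: s] with [s \subset U], the family [S] contains
   precisely those with [s] empty or in [A]. This happens with probability at
   least [2 ^- (2 ^ r)], independently for distinct [v], so a union bound over
   [(U, A)] bounds the probability of non-ampleness by
   [(n + 1) ^ r * 2 ^ (2 ^ r) * (1 - 2 ^- (2 ^ r)) ^ (n - r)]. *)

Require Import Defs.
From mathcomp Require Import all_boot all_order all_algebra.

Import Order.TTheory GRing.Theory Num.Theory.
Local Open Scope ring_scope.
Set Implicit Arguments.
Unset Strict Implicit.
Unset Printing Implicit Defensive.

(** * Counting families with prescribed or forbidden traces *)

Section RandomFamily.
Variable I : finType.
Implicit Types (B C S : {set I}) (M : {set {set I}}).

(* [S] is recovered from its trace on [B] and its overwritten copy. *)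
Lemma card_trace_eq B C M : C \subset B ->
  (forall S, S \in M -> S :\: B :|: C \in M) ->
  (#|M| <= 2 ^ #|B| * #|[set S in M | S :&: B == C]|)%N.
Proof.
move=> CB stab; rewrite -card_powerset -cardsX.
pose f S := (S :&: B, S :\: B :|: C).
have f_inj : injective f.
  move=> S1 S2 [/setP e1 /setP e2]; apply/setP => x.
  move: (e1 x) (e2 x); rewrite !inE.
  have [xB|xB] := boolP (x \in B); first by rewrite !andbT.
  by rewrite (negbTE (contra (subsetP CB x) xB)) !orbF.
rewrite -(card_imset _ f_inj) subset_leq_card //.
apply/subsetP => _ /imsetP[S SM ->].
rewrite !inE subsetIr /= stab //=.
apply/eqP/setP => x; rewrite !inE.
have [xB|xB] := boolP (x \in B); first by rewrite andbT.
by rewrite andbF (negbTE (contra (subsetP CB x) xB)).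
Qed.

(** Independence in counting form, by induction on [vs]. Overwriting the trace on [B v] by [C v]
    leaves the traces on the other, disjoint blocks unchanged, so each new block removes at least
    the fraction [2 ^- K] of the families that remain. *)
Lemma card_avoid (R : numFieldType) (J : eqType) (B C : J -> {set I}) (K : nat)
    (vs : seq J) :
  uniq vs ->
  {in vs, forall v, C v \subset B v} -> {in vs, forall v, #|B v| <= K}%N ->
  {in vs &, forall v w, v != w -> [disjoint B v & B w]} ->
  #|[set S : {set I} | all (fun v => S :&: B v != C v) vs]|%:R
    <= 2 ^+ #|I| * (1 - 2 ^- K) ^+ size vs :> R.
Proof.
elim: vs => [|v vs IH] /=.
  move=> _ _ _ _; rewrite expr0 mulr1 -natrX ler_nat.
  have <- : #|[set: {set I}]| = (2 ^ #|I|)%N.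
    by rewrite -powersetT card_powerset cardsT.
  by apply: subset_leq_card; apply/subsetP => S; rewrite inE.
move=> /andP[vvs uvs] CB BK Bd.
have mem w : w \in vs -> w \in v :: vs by move=> h; rewrite inE h orbT.
have vin : v \in v :: vs by rewrite mem_head.
pose M := [set S : {set I} | all (fun v => S :&: B v != C v) vs].
have {}IH : #|M|%:R <= 2 ^+ #|I| * (1 - 2 ^- K) ^+ size vs :> R.
  by apply: IH => //; [move=> w /mem; exact: CB | move=> w /mem; exact: BK |
    move=> w x /mem hw /mem; exact: Bd].
pose G := [set S in M | S :&: B v == C v].
have MG : (#|M| <= 2 ^ #|B v| * #|G|)%N.
  apply: card_trace_eq; first exact: CB.
  move=> S; rewrite !inE => /allP h; apply/allP => w wvs.
  rewrite (_ : _ :&: B w = S :&: B w) ?h //.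
  have vw : v != w by apply: contraNneq vvs => ->.
  have d := Bd _ _ vin (mem _ wvs) vw.
  apply/setP => x; rewrite !inE.
  have [xB|] := boolP (x \in B w); last by rewrite !andbF.
  have xv : x \notin B v by rewrite (disjointFl d xB).
  by rewrite xv (negbTE (contra (subsetP (CB _ vin) x) xv)) orbF !andbT.
have -> : [set S : {set I} | (S :&: B v != C v) &&
             all (fun v => S :&: B v != C v) vs] = M :\: G.
  apply/setP => S; rewrite !inE.
  by case: (all _ _); rewrite /= ?andbT ?andbF.
have GM : G \subset M by apply/subsetP => S; rewrite inE => /andP[].
have p0 : 0 < 2 ^+ K :> R by rewrite exprn_gt0.
rewrite cardsD (setIidPr GM) natrB ?subset_leq_card //.
have h : #|M|%:R * 2 ^- K <= #|G|%:R :> R.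
  rewrite ler_pdivrMr // -natrX -natrM ler_nat mulnC.
  by apply: leq_trans MG _; rewrite leq_mul2r leq_exp2l // BK ?orbT.
apply: (@le_trans _ _ (#|M|%:R * (1 - 2 ^- K))).
  by rewrite mulrBr mulr1 lerD2l lerN2.
rewrite exprSr mulrA; apply: ler_wpM2r IH.
by rewrite subr_ge0 invf_le1 // exprn_ege1 // ler1n.
Qed.

End RandomFamily.

(** Each such set is the set of proper values of a map from ['I_r] to [option T]: list its points
    and pad with [None]. *)
Lemma card_small_sets (T : finType) (r : nat) :
  (#|[set U : {set T} | #|U| <= r]| <= #|T|.+1 ^ r)%N.
Proof.
pose f (t : {ffun 'I_r -> option T}) := [set x | Some x \in codom t].
have -> : (#|T|.+1 ^ r = #|[set: {ffun 'I_r -> option T}]|)%N.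
  by rewrite cardsT card_ffun card_option card_ord.
apply: leq_trans (leq_imset_card f _); apply: subset_leq_card.
apply/subsetP => U; rewrite inE => Ur; apply/imsetP.
exists [ffun i : 'I_r => onth (enum U) i]; rewrite ?inE //.
apply/setP => x; rewrite inE; apply/idP/codomP => [xU|[i]].
  have xe : x \in enum U by rewrite mem_enum.
  have lt : (index x (enum U) < r)%N.
    by apply: leq_trans Ur; rewrite cardE index_mem.
  exists (Ordinal lt); rewrite ffunE /=.
  by rewrite onthE (nth_map x) ?index_mem // nth_index.
rewrite ffunE => /esym; rewrite onthE.
have [lt|ge] := ltnP i (size (enum U)); last by rewrite nth_default // size_map.
by rewrite (nth_map x) // => -[<-]; rewrite -mem_enum mem_nth.
Qed.

(** * From non-ampleness to a union bound *)

Section Ampleness.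
Variable T : finType.
Implicit Types (X A S : {set {set T}}) (U s t : {set T}) (v : T).

(* For a uniformly random family [S], the random complex is the largest complex
   contained in [S]; [interval X] is the event that this complex is [X]. *)
Definition interval X : {set {set {set T}}} :=
  [set S | S :&: (X :|: external X) == X].

(** Hence [S] determines [X], and distinct complexes have disjoint intervals. By induction on the
    size of [s], all proper faces of [s] lie in [X]; if [s] did not, it would be in [external X],
    which [S] misses. *)
Lemma intervalP X S : is_complex X -> S \in interval X ->
  X = [set s | (s != set0) &&
         [forall t, (t != set0) && (t \subset s) ==> (t \in S)]].
Proof.
move=> /andP[X0 /forall_inP Xd]; rewrite inE => /eqP /setP SX.
have XS s : s \in X -> s \in S by rewrite -SX inE => /andP[].
apply/setP => s; rewrite inE; apply/idP/andP => [sX|[]].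
  split; first by apply: contraNneq X0 => <-.
  apply/forallP => t; apply/implyP => tP; apply: XS.
  exact: (implyP (forallP (Xd s sX) t)).
elim: {s}#|s| {-2}s (leqnn #|s|) => [|n IH] s.
  by rewrite leqn0 cards_eq0 => /eqP ->; rewrite eqxx.
move=> sn s0 /forallP sc.
have sS : s \in S by move: (sc s); rewrite s0 subxx.
move: (SX s); rewrite !inE sS s0 /=; case: (s \in X) => //= <-.
apply/forallP => t; apply/implyP => /andP[t0 ts]; apply: IH => //.
  by rewrite -ltnS; apply: leq_trans (proper_card ts) sn.
apply/forallP => u; apply/implyP => /andP[u0 ut]; apply: (implyP (sc u)).
by rewrite u0 (subset_trans ut (proper_sub ts)).
Qed.

Lemma card_interval X : (2 ^ #|{set T}| <= 2 ^ energy X * #|interval X|)%N.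
Proof.
have h := @card_trace_eq _ (X :|: external X) X [set: {set {set T}}]
  (subsetUl _ _) (fun _ _ => in_setT _).
rewrite -powersetT card_powerset cardsT in h; apply: leq_trans h _.
rewrite leq_mul //; first by rewrite leq_exp2l // cardsU leq_subr.
by apply: subset_leq_card; apply/subsetP => S; rewrite !inE => /andP[].
Qed.

Definition cone v (F : {set {set T}}) : {set {set T}} := [set v |: s | s in F].

(* Dominates the event that the pair [(U, A)] witnesses non-ampleness of the
   complex of [S]; the traces on distinct cones are independent. *)
Definition no_extension U A : {set {set {set T}}} :=
  [set S | all (fun v => S :&: cone v (powerset U) != cone v (set0 |: A))
             (enum (~: U))].

Lemma mem_cone v (F : {set {set T}}) s : v \notin s -> {in F, forall t, v \notin t} ->
  (v |: s \in cone v F) = (s \in F).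
Proof.
move=> vs vF; apply/imsetP/idP => [[t tF e]|sF]; last by exists s.
suff -> : s = t by [].
by rewrite -(setU1K vs) e setU1K // vF.
Qed.

(** Contrapositive: if the trace of [S] on the cone at some [v] outside [U] is the prescribed one,
    then [v] is a vertex of [X] whose link meets [induced X U] in exactly [A]. *)
Lemma not_ample_no_extension r X S : is_complex X -> S \in interval X ->
  ~~ ample r X ->
  exists2 U : {set T}, (#|U| <= r)%N &
    exists2 A : {set {set T}}, A \subset powerset U & S \in no_extension U A.
Proof.
move=> cX SX; have XE := intervalP cX SX.
have [X0 /forall_inP Xd] := andP cX.
suff ext U A : is_complex A -> A \subset induced X U -> S \notin no_extension U A ->
    exists v, (v \in vertices X :\: U) && (link X v :&: induced X U == A).
  have AU U A : A \subset induced X U -> A \subset powerset U.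
    by move=> /subsetP h; apply/subsetP => s /h; rewrite !inE => /andP[].
  rewrite /ample negb_and negbK => /orP[/eqP Xe|].
    (* For the empty complex the pair of empty sets is a witness, since an extension would need a
       vertex. *)
    exists set0; rewrite ?cards0 //; exists set0; rewrite ?sub0set //.
    apply: contraT => /ext[]; rewrite ?sub0set //.
      by rewrite /is_complex inE; apply/forall_inP => s; rewrite inE.
    by move=> v; rewrite Xe !inE andbF.
  rewrite negb_forall => /existsP[U]; rewrite negb_imply => /andP[/andP[_ Ur]].
  rewrite negb_forall => /existsP[A]; rewrite negb_imply => /andP[/andP[cA AX] ne].
  exists U => //; exists A; first exact: AU.
  by apply: contraR ne => /(ext _ _ cA AX) /existsP.
move=> cA AX; rewrite inE => /allPn[v]; rewrite mem_enum inE negbK => vU /eqP/setP Sv.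
have [A0 /forall_inP Ad] := andP cA.
have AU : {in A, forall s, s \subset U}.
  by move=> s /(subsetP AX); rewrite inE => /andP[].
have vsub s : s \subset U -> v \notin s by move=> /subsetP h; apply: contra vU => /h.
have key s : s \subset U -> (v |: s \in S) = (s == set0) || (s \in A).
  move=> sU; move: (Sv (v |: s)); rewrite inE !mem_cone ?vsub //.
  - by rewrite !inE sU andbT.
  - by move=> t; rewrite !inE => /orP[/eqP->|/AU /vsub]; rewrite ?inE.
  - by move=> t; rewrite inE => /vsub.
have XS s : s \in X -> s \in S.
  by rewrite XE inE => /andP[s0 /forallP/(_ s)]; rewrite s0 subxx.
(* All nonempty faces must lie in [S]: those through [v] by the prescribed trace, the others because
   they belong to [A], hence to [X]. *)
have coneX s : s == set0 \/ s \in A -> v |: s \in X.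
  move=> sA; rewrite XE inE; apply/andP; split.
    by apply/set0Pn; exists v; rewrite setU11.
  apply/forallP => t; apply/implyP => /andP[t0 ts].
  have sU : s \subset U by case: sA => [/eqP->|/AU//]; rewrite sub0set.
  have tvs : t :\ v \subset s by rewrite subDset.
  have face (u : {set T}) : u \subset s -> (u == set0) || (u \in A).
    case: sA => [/eqP->|sA]; first by rewrite subset0 => ->.
    move=> us; have [//|u0] := eqVneq u set0.
    by apply: (implyP (forallP (Ad _ sA) u)); rewrite u0.
  have [vt|vt] := boolP (v \in t).
    rewrite -(setD1K vt) key; first exact: face.
    exact: subset_trans tvs sU.
  have te : t :\ v = t by apply/setDidPl; rewrite disjoint_sym disjoints1.
  move: (face _ tvs); rewrite te (negbTE t0) /= => tA.
  by apply: XS; move: (subsetP AX t tA); rewrite inE => /andP[].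
exists v; apply/andP; split.
  (* The empty set in the prescribed trace is what makes [v] a vertex. *)
  by rewrite !inE vU /= -[[set v]]setU0 coneX //; left.
apply/eqP/setP => s; rewrite !inE; apply/idP/idP.
  move=> /andP[/and3P[sX vs vsX] /andP[_ sU]].
  move: (XS _ vsX); rewrite key // => /orP[/eqP s0|//].
  by move: X0; rewrite -s0 sX.
move=> sA; have := subsetP AX s sA; rewrite inE => /andP[-> sU].
by rewrite sU vsub //= coneX //; right.
Qed.

Lemma card_no_extension (R : numFieldType) r U A :
  (#|U| <= r)%N -> A \subset powerset U ->
  #|no_extension U A|%:R
    <= 2 ^+ #|{set T}| * (1 - 2 ^- (2 ^ r)) ^+ (#|T| - r) :> R.
Proof.
move=> Ur AU.
have q0 : 0 <= 1 - 2 ^- (2 ^ r) :> R.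
  by rewrite subr_ge0 invf_le1 ?exprn_gt0 // exprn_ege1 // ler1n.
have p0 : 0 < 2 ^- (2 ^ r) :> R by rewrite invr_gt0 exprn_gt0.
have vsub v s : v \notin U -> s \subset U -> v \notin s.
  by move=> vU /subsetP h; apply: contra vU => /h.
apply: le_trans (card_avoid _ (K := 2 ^ r) (enum_uniq _) _ _ _) _.
- move=> v _; apply: imsetS; apply/subsetP => s; rewrite !inE => /orP[/eqP->|].
    exact: sub0set.
  by move=> /(subsetP AU); rewrite inE.
- move=> v _; apply: leq_trans (leq_imset_card _ _) _.
  by rewrite card_powerset leq_exp2l.
(* A member of a cone contains its apex and no other point outside [U], so cones with distinct
   apexes are disjoint. *)
- move=> v w; rewrite !mem_enum !inE => vU wU vw.
  apply/pred0P => s /=; apply/negbTE/negP => /andP[/imsetP[t tU ->] /imsetP[u uU e]].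
  rewrite !inE in tU uU.
  move: (setU11 v t); rewrite e !inE (negbTE vw) /= => vu.
  by move: (vsub _ _ vU uU); rewrite vu.
- rewrite ler_pM2l ?exprn_gt0 // -cardE cardsCs setCK.
  apply: ler_wiXn2l => //; first by rewrite gerBl ltW.
  exact: leq_sub2l.
Qed.

Lemma not_ample_prob_le (R : numFieldType) r :
  complex_prob R (fun X : subcomplex T => ~~ ample r X)
    <= (#|T|.+1 ^ r * 2 ^ 2 ^ r)%:R * (1 - 2 ^- (2 ^ r)) ^+ (#|T| - r).
Proof.
have p0 k : 0 < 2 ^+ k :> R by rewrite exprn_gt0.
pose q : R := (1 - 2 ^- (2 ^ r)) ^+ (#|T| - r).
have q0 : 0 <= q.
  by rewrite exprn_ge0 // subr_ge0 invf_le1 // exprn_ege1 // ler1n.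
pose P := [set UA : {set T} * {set {set T}} |
             (#|UA.1| <= r)%N && (UA.2 \subset powerset UA.1)].
have cP : (#|P| <= #|T|.+1 ^ r * 2 ^ 2 ^ r)%N.
  pose Us := [set U : {set T} | #|U| <= r]%N.
  have -> : #|P| = (\sum_(U in Us) #|powerset (powerset U)|)%N.
    rewrite -sum1_card (eq_bigr (fun U => \sum_(A in powerset (powerset U)) 1)%N).
      rewrite pair_big_dep /=; apply: eq_bigl => -[U A]; by rewrite !inE.
    by move=> U _; rewrite sum1_card.
  apply: leq_trans (_ : \sum_(U in Us) 2 ^ 2 ^ r <= _)%N.
    apply: leq_sum => U; rewrite inE => Ur.
    by rewrite !card_powerset !leq_exp2l.
  by rewrite sum_nat_const leq_mul2r card_small_sets orbT.
pose bad (X : subcomplex T) := ~~ ample r X.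
pose W := [set S | [exists X : subcomplex T, bad X && (S \in interval X)]].
(* [W] is the disjoint union of the intervals of bad complexes, and each interval fills at least the
   share [2 ^- energy X] of all families. *)
have prob_le : complex_prob R bad * 2 ^+ #|{set T}| <= #|W|%:R.
  have -> : #|W| = (\sum_(X | bad X) #|interval X|)%N.
    transitivity (\sum_(X | bad X) \sum_(S in interval X) 1)%N; last first.
      by apply: eq_bigr => X _; rewrite sum1_card.
    rewrite (exchange_big_dep predT) //= -sum1_card [RHS](bigID (mem W)) /=.
    rewrite [X in (_ + X)%N]big1 ?addn0 => [|S]; last first.
      rewrite inE negb_exists => /forallP h.
      by apply: big1 => X hX; move: (h X); rewrite hX.
    apply: eq_bigr => S; rewrite inE => /existsP[X0 hX].
    rewrite (big_pred1 X0) // => X /=; apply/idP/eqP => [/andP[_ h]|->//].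
    case/andP: hX => _ h0; apply: val_inj => /=.
    by rewrite (intervalP (valP X) h) (intervalP (valP X0) h0).
  rewrite mulr_suml natr_sum; apply: ler_sum => X _.
  rewrite /complex_law ler_pdivrMl // -!natrX -natrM ler_nat.
  exact: card_interval.
have W_sub : W \subset \bigcup_(UA in P) no_extension UA.1 UA.2.
  apply/subsetP => S; rewrite inE => /existsP[X /andP[nX SX]].
  have [U Ur [A AU SA]] := not_ample_no_extension (valP X) SX nX.
  by apply/bigcupP; exists (U, A); rewrite // inE Ur.
have W_le : #|W|%:R <= (#|T|.+1 ^ r * 2 ^ 2 ^ r)%:R * q * 2 ^+ #|{set T}| :> R.
  apply: le_trans (_ : \sum_(UA in P) (2 ^+ #|{set T}| * q) <= _).
    apply: le_trans (_ : (\sum_(UA in P) #|no_extension UA.1 UA.2|)%:R <= _).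
      rewrite ler_nat; apply: leq_trans (subset_leq_card W_sub) _.
      elim/big_ind2: _ => [|n1 E1 n2 E2 h1 h2|//]; first by rewrite cards0.
      by apply: leq_trans (leq_card_setU _ _) _; rewrite leq_add.
    rewrite natr_sum; apply: ler_sum => UA; rewrite inE => /andP[Ur AU].
    exact: card_no_extension.
  rewrite sumr_const -[_ *+ _]mulr_natl -mulrA (mulrC q).
  by apply: ler_wpM2r; rewrite ?ler_nat // mulr_ge0 // ltW.
by rewrite -(ler_pM2r (p0 #|{set T}|)); apply: le_trans prob_le W_le.
Qed.

End Ampleness.

(* Asymptotics and the limit *)
From mathcomp Require Import all_classical all_reals all_analysis.
Import numFieldNormedType.Exports.
Local Open Scope classical_set_scope.
Local Open Scope ring_scope.

(* From [q <= exp (q - 1)] and [exp x >= 1 + x] at [x = (1 - q) n / (r + 1)]. *)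
Lemma polynomial_geometric_le (R : realType) (r n : nat) (q : R) : 0 <= q < 1 ->
  n.+1%:R ^+ r * q ^+ n <= (r.+1%:R / (1 - q)) ^+ r.+1 * n.+1%:R^-1.
Proof.
move=> /andP[q0 q1]; set h := 1 - q.
have h0 : 0 < h by rewrite subr_gt0.
have h1 : h <= 1 by rewrite gerBl.
have r0 : 0 < r.+1%:R :> R by [].
have n0 : 0 < n.+1%:R :> R by [].
set c := h / r.+1%:R.
have c0 : 0 < c by rewrite divr_gt0.
(* This gives [c * n.+1 <= 1 + c * n <= expR (c * n)]; the power [r.+1] then beats [n.+1 ^ r] by one
   factor. *)
have c1 : c <= 1.
  by rewrite ler_pdivrMr // mul1r (le_trans h1) // ler1n.
have qn : q ^+ n <= expR (- (c * n%:R)) ^+ r.+1.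
  have -> : expR (- (c * n%:R)) ^+ r.+1 = expR (n%:R * - h).
    rewrite -expRM_natl; congr expR; rewrite !mulrN mulrA; congr (- _).
    by rewrite /c mulrCA divff ?gt_eqF // mulr1 mulrC.
  rewrite expRM_natl; apply: lerXn2r; rewrite ?nnegrE ?expR_ge0 //.
  apply: le_trans (expR_ge1Dx _); by rewrite /h opprB addrC subrK.
have en : expR (- (c * n%:R)) <= (c * n.+1%:R)^-1.
  rewrite expRN lef_pV2 ?posrE ?expR_gt0 ?mulr_gt0 //.
  apply: le_trans (expR_ge1Dx _).
  by rewrite -natr1 mulrDr mulr1 addrC lerD2r.
apply: le_trans (_ : n.+1%:R ^+ r * (c * n.+1%:R)^-1 ^+ r.+1 <= _).
  rewrite ler_pM2l ?exprn_gt0 //; apply: le_trans qn _.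
  by apply: lerXn2r; rewrite // nnegrE ?expR_ge0 // invr_ge0 mulr_ge0 // ltW.
rewrite invfM exprMn mulrCA -{1}[c]invf_div invrK.
rewrite ler_pM2l ?exprn_gt0 ?divr_gt0 //.
by rewrite exprSr mulrA -exprMn divff ?gt_eqF // expr1n mul1r.
Qed.

Theorem theorem3p2 (R : realType) (r : nat) (hr : (1 <= r)%N) :
  (fun n : nat => complex_prob R (fun X : subcomplex 'I_n => ample r X))
    @ \oo --> (1 : R).
Proof.
pose q : R := 1 - 2 ^- (2 ^ r).
have p1 : 1 < 2 ^+ (2 ^ r) :> R.
  by rewrite exprn_egt1 ?ltr1n // -lt0n expn_gt0.
have p0 : 0 < 2 ^+ (2 ^ r) :> R by rewrite exprn_gt0.
have q0 : 0 < q by rewrite subr_gt0 invf_lt1.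
have q1 : q < 1 by rewrite gtrBl invr_gt0.
(* The factors come from the number of complexes [A], from replacing the exponent [n - r] by [n],
   and from [polynomial_geometric_le]. *)
pose C : R := 2 ^+ (2 ^ r) * (q ^- r * (r.+1%:R / (1 - q)) ^+ r.+1).
have sum1 n : complex_prob R (fun X : subcomplex 'I_n => ample r X) =
    1 - complex_prob R (fun X : subcomplex 'I_n => ~~ ample r X).
  rewrite -(complex_prob_total 'I_n R) /complex_prob.
  by rewrite [in RHS](bigID (fun X : subcomplex 'I_n => ample r X)) /= addrK.
have lower : (fun n : nat => 1 - C * n.+1%:R^-1) @ \oo --> (1 : R).
  rewrite -[X in _ --> X]subr0 -[X in _ --> _ - X](mulr0 C).
  by apply: cvgB; [exact: cvg_cst | apply: cvgM; [exact: cvg_cst | exact: cvg_harmonic]].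
apply: squeeze_cvgr lower (cvg_cst (1 : R)).
near=> n.
(* For smaller [n] the truncated [n - r] would break the splitting of [q ^+ n]. *)
have rn : (r <= n)%N by near: n; exists r.
rewrite sum1 gerBl lerD2l lerN2; apply/andP; split; last first.
  by apply: sumr_ge0 => X _; rewrite invr_ge0 exprn_ge0.
apply: le_trans (not_ample_prob_le _ _ _) _; rewrite card_ord natrM !natrX -/q.
have -> : q ^+ (n - r) = q ^- r * q ^+ n.
  by rewrite -{2}(subnKC rn) exprD mulKf // expf_neq0 // gt_eqF.
rewrite /C -!mulrA (mulrCA (n.+1%:R ^+ r)) ler_pM2l //.
rewrite (mulrCA (n.+1%:R ^+ r)) ler_pM2l ?invr_gt0 ?exprn_gt0 //.
by apply: polynomial_geometric_le; rewrite ltW.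
Unshelve. all: by end_near.
Qed.
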